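(* Let $\alpha,\beta\ge1$ be real numbers. As $X\to\infty$, $$\frac{\#\mathcal{E}(X;H_{\alpha,\beta})}{\#\widetilde{\mathcal{E}}(X;H_{\alpha,\beta})}=\frac{1}{\zeta(10)}+O(X^{-1/3}).$$
   Context: For $(A,B)\in\mathbb{Z}^2$ let $E_{A,B}$ denote the curve $y^2=x^3+Ax+B$; curves are counted by their pairs $(A,B)$. Let $\widetilde{\mathcal{E}}$ be the set of all $E_{A,B}$ with $A,B\in\mathbb{Z}$ and $-16(4A^3+27B^2)\neq 0$. Let $\mathcal{E}$ be the set of $E_{A,B}\in\widetilde{\mathcal{E}}$ such that there is no prime $p$ with $p^4\mid A$ and $p^6\mid B$ (a complete set of representatives for the $\mathbb{Q}$-isomorphism classes of elliptic curves over $\mathbb{Q}$). For real $\alpha,\beta\ge1$, $H_{\alpha,\beta}(E_{A,B}):=\max\{\alpha|A|^3,\beta B^2\}$, and for a family $\mathcal{F}$ and $X>0$, $\mathcal{F}(X;H_{\alpha,\beta}):=\{E_{A,B}\in\mathcal{F}: H_{\alpha,\beta}(E_{A,B})\le X\}$. $\zeta$ is the Riemann zeta function. The parameters $\alpha,\beta$ are fixed; the implied constant may depend on them. *)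

(* Defs.v *)
From HB Require Import structures.
From mathcomp Require Import all_boot all_order all_algebra.
From mathcomp Require Import finmap.
From mathcomp Require Import all_classical all_reals all_analysis.

Set Implicit Arguments.
Unset Strict Implicit.
Unset Printing Implicit Defensive.

Import Order.TTheory GRing.Theory Num.Theory.
Import numFieldNormedType.Exports.

Local Open Scope classical_set_scope.
Local Open Scope ring_scope.

(* The pair (A, B) stands for the curve E_{A,B} : y^2 = x^3 + A x + B;
   isomorphic curves given by distinct pairs are counted separately. *)
Definition weierstrass : Type := (int * int)%type.

Definition disc (E : weierstrass) : int :=
  - (16 * (4 * E.1 ^+ 3 + 27 * E.2 ^+ 2)).

Definition all_curves : set weierstrass := [set E | disc E != 0].

Definition minimal_curves : set weierstrass :=
  [set E | all_curves E /\
     ~ exists p : nat, [/\ prime p, (p%:Z ^+ 4 %| E.1)%Z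
                          & (p%:Z ^+ 6 %| E.2)%Z]].

Definition height (R : realType) (alpha beta : R) (E : weierstrass) : R :=
  Num.max (alpha * `|E.1%:~R| ^+ 3) (beta * E.2%:~R ^+ 2).

Definition bounded_height (R : realType) (alpha beta : R)
    (F : set weierstrass) (X : R) : set weierstrass :=
  [set E | F E /\ height alpha beta E <= X].

(* [fset_set] sends infinite sets to the empty one, but
   [bounded_height alpha beta F X] is finite as soon as alpha, beta > 0. *)
Definition ncurves (R : realType) (alpha beta : R)
    (F : set weierstrass) (X : R) : nat :=
  #|` fset_set (bounded_height alpha beta F X)|%fset.

(* Dirichlet series; this is the Riemann zeta function only for 1 < s. *)
Definition zeta (R : realType) (s : R) : R := limn (series (riemannR s)).

(* Main.v *)
(* Put [s = X ^ (1/6)].  Every curve is uniquely the twist [(d^4 A, d^6 B)] of a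
   minimal one, and twisting multiplies the height by [d^12]; so the counting
   functions [T] (all curves) and [N] (minimal curves) satisfy
   [T s = \sum_(d >= 1) N (s / d^2)].  Counting lattice points in a box gives
   [T s = c s^5 + O(s^3)] for all [s > 0].  Instead of a Moebius inversion, put
   [f s = N s - (c / zeta 10) s^5]: then
   [f s = O(s^3) - \sum_(d >= 2) f (s / d^2)], and since [\sum_(d >= 2) d^-6 <= 1/2], a bound
   [|f| <= M s^3] below [s / 4] propagates to [s] once [M] is large.  Dividing
   by [T s >= c s^5 / 2] gives the error term [O(s^-2)]. *)
Require Import Defs.
From mathcomp Require Import all_boot all_order all_algebra finmap ring lra zify.
From mathcomp Require Import all_classical all_reals all_analysis.
Import Order.TTheory GRing.Theory Num.Theory.
Import numFieldNormedType.Exports.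
Set Implicit Arguments.
Unset Strict Implicit.
Unset Printing Implicit Defensive.
Local Open Scope classical_set_scope.
Local Open Scope ring_scope.

(** * Twists and the unique minimal model *)

Definition twist (d : nat) (E : weierstrass) : weierstrass :=
  (d%:Z ^+ 4 * E.1, d%:Z ^+ 6 * E.2).

Lemma twist_inj (d : nat) : (0 < d)%N -> injective (twist d).
Proof.
move=> d0 [A B] [A' B'] [].
have dn n : d%:Z ^+ n != 0 by rewrite expf_neq0// eqz_nat -lt0n.
by move=> /(mulfI (dn 4)) -> /(mulfI (dn 6)) ->.
Qed.

Lemma twistM (d e : nat) (E : weierstrass) :
  twist (d * e) E = twist d (twist e E).
Proof. by rewrite /twist /= PoszM !exprMn !mulrA. Qed.

Lemma disc_twist (d : nat) (E : weierstrass) :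
  disc (twist d E) = d%:Z ^+ 12 * disc E.
Proof. by rewrite /disc/=; ring. Qed.

Lemma all_curves_twist (d : nat) (E : weierstrass) :
  (0 < d)%N -> all_curves (twist d E) <-> all_curves E.
Proof.
move=> d0; rewrite /all_curves/= disc_twist mulf_eq0 expf_eq0/=.
by rewrite eqz_nat (gtn_eqF d0).
Qed.

Lemma height_twist (R : realType) (alpha beta : R) (d : nat) (E : weierstrass) :
  height alpha beta (twist d E) = d%:R ^+ 12 * height alpha beta E.
Proof.
rewrite /height/= maxr_pMr ?exprn_ge0//.
rewrite !intrM -!pmulrn !normrM normr_nat.
by congr Num.max; ring.
Qed.

Lemma minimal_curves_dvd (E : weierstrass) (e : nat) : minimal_curves E ->
  (e%:Z ^+ 4 %| E.1)%Z -> (e%:Z ^+ 6 %| E.2)%Z -> e = 1%N.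
Proof.
move=> [_ Emin] e1 e2; apply: contrapT => en1; apply: Emin.
have [p pp pe] : exists2 p, prime p & (p %| e)%N.
  (* Every prime divides [e = 0], so 2 serves there. *)
  case: e en1 {e1 e2} => [|[|e]] // _; first by exists 2.
  by exists (pdiv e.+2); [exact: pdiv_prime|exact: pdiv_dvd].
by exists p; split=> //; [apply: dvdz_trans e1|apply: dvdz_trans e2];
  apply: dvdz_exp2r.
Qed.

(** By Gauss, [d^4] is coprime to [e^4] and divides [e^4 A'], so it divides [A']; likewise [d^6]
    divides [B'], and minimality of [E' = (A', B')] leaves only [d = 1]. *)
Lemma twist_coprime_minimal (d e : nat) (E E' : weierstrass) :
  coprime d e -> minimal_curves E' -> twist d E = twist e E' -> d = 1%N.
Proof.
move=> cde E'min [] eq1 eq2.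
have cop m : coprimez (d%:Z ^+ m) (e%:Z ^+ m).
  by apply: coprimezXl; apply: coprimezXr; rewrite coprimezE.
apply: (minimal_curves_dvd E'min).
- by rewrite -(Gauss_dvdzr _ (cop 4)) -eq1 dvdz_mulr.
- by rewrite -(Gauss_dvdzr _ (cop 6)) -eq2 dvdz_mulr.
Qed.

(** After cancelling [gcd(d, e)] the two cofactors are coprime, and the coprime case, applied in
    both directions, makes each of them 1. *)
Lemma twist_minimal_uniq (d e : nat) (E E' : weierstrass) :
  (0 < d)%N -> minimal_curves E -> minimal_curves E' ->
  twist d E = twist e E' -> d = e.
Proof.
move=> d0 Emin E'min.
have g0 : (0 < gcdn d e)%N by rewrite gcdn_gt0 d0.
have /dvdnP[d' dE] := dvdn_gcdl d e; have /dvdnP[e' eE] := dvdn_gcdr d e.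
have cde : coprime d' e'.
  by rewrite /coprime -(eqn_pmul2r g0) muln_gcdl -dE -eE mul1n.
move: g0 dE eE; move: (gcdn d e) => g g0 -> ->.
rewrite ![(_ * g)%N]mulnC !twistM => /(twist_inj g0) eqE.
rewrite (twist_coprime_minimal cde E'min eqE).
rewrite coprime_sym in cde.
by rewrite (twist_coprime_minimal cde Emin (esym eqE)).
Qed.

(** Descent on the absolute discriminant: undoing a twist by a prime [p] divides it by [p^12]. *)
Lemma twist_minimal_exists (E : weierstrass) : all_curves E ->
  exists d E', [/\ (0 < d)%N, minimal_curves E' & E = twist d E'].
Proof.
have [n] := ubnP `|disc E|%N; elim: n E => // n IH E En Eall.
have [Emin|] := pselect (minimal_curves E).
  exists 1%N, E; split=> //.
  by case: E {En Eall Emin} => A B; rewrite /twist !expr1n !mul1r.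
move=> /not_andP[//|/contrapT[p [pp /dvdzP[A EA] /dvdzP[B EB]]]].
have EE : E = twist p (A, B).
  by rewrite /twist/= mulrC -EA mulrC -EB; case: E {En Eall EA EB}.
have p0 := prime_gt0 pp.
move: Eall; rewrite EE => /(all_curves_twist _ p0) AB.
have [|d [E' [d0 E'min ->]]] := IH (A, B) _ AB.
  rewrite -ltnS; apply: leq_trans En; rewrite EE disc_twist abszM abszX.
  rewrite ltnS ltn_Pmull ?absz_gt0//.
  by rewrite -(exp1n 12) ltn_exp2r// prime_gt1.
by exists (p * d)%N, E'; rewrite muln_gt0 p0 d0 twistM.
Qed.

(** * The series of inverse sixth powers and zeta(10) *)

(** Telescoping: for [x >= 1], [(x + 1)^-6] is at most half of [1/(x (x + 1)) = 1/x - 1/(x + 1)]. *)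
Lemma sum_inv_exp6_le (R : realType) (n : nat) :
  \sum_(i < n) (i.+2%:R ^+ 6)^-1 <= 2^-1 :> R.
Proof.
suff H : \sum_(i < n) (i.+2%:R ^+ 6)^-1 <= 2^-1 - 2^-1 * n.+1%:R^-1 :> R.
  by apply: le_trans H _; rewrite lerBlDr lerDl mulr_ge0 ?invr_ge0.
elim: n => [|n IH]; first by rewrite big_ord0; lra.
rewrite big_ord_recr/=; apply: le_trans (lerD IH (lexx _)) _.
set x : R := n.+1%:R.
have x1 : 1 <= x by rewrite ler1n.
have -> : n.+2%:R = x + 1 :> R by rewrite /x -(natrD _ _ 1) addn1.
have -> : 2^-1 - 2^-1 * (x+1)^-1 =
  2^-1 - 2^-1 * x^-1 + 2^-1 * (x * (x + 1))^-1.
  by field; apply/andP; split; lra.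
rewrite lerD2l -invfM lef_pV2 ?posrE;
  [|by apply: exprn_gt0; lra|by rewrite !mulr_gt0//; lra].
have y4 : 2 <= (x + 1) ^+ 4 by nra.
rewrite (_ : (x + 1) ^+ 6 = (x + 1) ^+ 4 * (x + 1) ^+ 2); last by ring.
by apply: ler_pM => //; nra.
Qed.

(** The partial sums increase and stay below [1 + 1/2], by comparison with the inverse sixth powers;
    hence the [limn] defining [zeta] is a genuine limit. *)
Lemma zeta10_cvg (R : realType) :
  (fun n => \sum_(i < n) (i.+1%:R ^+ 10)^-1) @ \oo --> zeta (10 : R).
Proof.
have -> : (fun n => \sum_(i < n) (i.+1%:R ^+ 10)^-1) =
    series (riemannR (10 : R)).
  apply/funext => n; rewrite /series/= big_mkord.
  apply: eq_bigr => i _; by rewrite /riemannR (powR_mulrn 10).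
suff : cvgn (series (riemannR (10 : R))) by [].
apply: nondecreasing_is_cvgn.
  apply: nondecreasing_series => n _ _ /=.
  by rewrite invr_ge0 powR_ge0.
exists (1 + 2^-1) => _ [n _ <-]; rewrite /series/= big_mkord.
case: n => [|n]; first by rewrite big_ord0; lra.
rewrite big_ord_recl /riemannR/= powR1 invr1 lerD2l.
apply: le_trans (sum_inv_exp6_le R n); apply: ler_sum => i _.
rewrite (powR_mulrn 10)// lef_pV2 ?posrE ?exprn_gt0//.
by apply: ler_weXn2l => //; rewrite ler1n.
Qed.

Lemma zeta10_ge1 (R : realType) : 1 <= zeta (10 : R).
Proof.
have cvg := @zeta10_cvg R.
rewrite -(cvg_lim _ cvg)//.
apply: limr_ge; first by apply/cvg_ex; eexists; exact: cvg.
exists 1%N => // n /= n1; case: n n1 => // n _.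
rewrite big_ord_recl/= expr1n invr1 lerDl; apply: sumr_ge0 => i _.
by rewrite invr_ge0 exprn_ge0.
Qed.

(** * From the count of all curves to the count of minimal ones *)

Lemma sieve_inversion (R : realType) (N T : R -> R) (c K : R) :
  0 <= c ->
  (forall s, 0 < s -> s < 1 -> N s = 0) ->
  (forall s (D : nat), 0 < s -> s ^+ 6 <= D%:R ->
     T s = \sum_(i < D) N (s / i.+1%:R ^+ 2)) ->
  (forall s, 0 < s -> `|T s - c * s ^+ 5| <= K * s ^+ 3) ->
  exists M, forall s, 0 < s -> `|N s - c / zeta 10 * s ^+ 5| <= M * s ^+ 3.
Proof.
move=> c0 N0 TN TK; set Z := zeta 10.
have Z1 : 1 <= Z := zeta10_ge1 R.
have Z0 : 0 < Z by lra.
have cZ0 : 0 <= c / Z by rewrite divr_ge0// ltW.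
have cZ : c / Z <= c by rewrite ler_pdivrMr//; nra.
(* The bound [c] settles [s < 1]; [2 (K + 1) <= M] gives [K + 1 + M / 2 <= M], which closes the
   induction. *)
set M := Num.max c (2 * (K + 1)).
have Mc : c <= M by rewrite le_max lexx.
have MK : 2 * (K + 1) <= M by rewrite le_max lexx orbT.
exists M.
(* Induction on dyadic ranges: for [d >= 2] the argument [s / d^2] is at most [s / 4], hence in an
   earlier range. *)
suff H k s : 0 < s -> s < 2 ^+ k -> `|N s - c / Z * s ^+ 5| <= M * s ^+ 3.
  move=> s s0; apply: (H (Num.bound s)) => //.
  apply: lt_le_trans (archi_boundP (ltW s0)) _.
  by rewrite -natrX ler_nat ltnW// ltn_expl.
elim: k s => [|k IH] s s0 sk.
  rewrite N0// sub0r normrN ger0_norm; last exact: mulr_ge0 cZ0 (exprn_ge0 5 (ltW s0)).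
  rewrite expr0 in sk.
  apply: ler_pM; rewrite ?exprn_ge0 ?(ltW s0)//; first exact: le_trans Mc.
  by apply: ler_wiXn2l => //; exact: ltW.
have s3 : 0 < s ^+ 3 by rewrite exprn_gt0.
(* The identity for [T] holds for every large [D], so [D] can also be taken so large that the
   truncated zeta sum costs at most [s^3], although it is multiplied by [c s^5]. *)
have [D sD zD] : exists2 D : nat, s ^+ 6 <= D.+1%:R &
    `|c * s ^+ 5 * (1 - (\sum_(i < D.+1) (i.+1%:R ^+ 10)^-1) / Z)| <= s ^+ 3.
  have : (fun n => c * s ^+ 5 * (1 - (\sum_(i < n.+1) (i.+1%:R ^+ 10)^-1) / Z))
     @ \oo --> (c * s ^+ 5 * (1 - Z / Z)).
    apply: cvgMr; apply: cvgB; first exact: cvg_cst.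
    apply: cvgMl.
    have := @zeta10_cvg R; rewrite -/Z -cvg_shiftS; exact.
  rewrite divff ?gt_eqF// subrr mulr0 => /cvgr0_norm_le /(_ _ s3) [n _ nP].
  exists (maxn n (Num.bound (s ^+ 6))); last by apply: nP; rewrite /= leq_maxl.
  apply: le_trans (ltW (archi_boundP _)) _; first by rewrite exprn_ge0// ltW.
  by rewrite ler_nat leqW// leq_maxr.
have := TK s s0; rewrite (TN s D.+1 s0 sD) => TKs.
move: zD TKs; rewrite !big_ord_recl/= !expr1n divr1 invr1.
set a := \sum_(i < D) _; set b := \sum_(i < D) _ => zD TKs.
(* The terms [d >= 2]: the induction hypothesis bounds each by [M s^3 d^-6], and these sum to at
   most half of [M s^3]. *)
have fab : `|b - c / Z * s ^+ 5 * a| <= M * s ^+ 3 * 2^-1.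
  rewrite /a /b mulr_sumr -sumrB.
  apply: le_trans (ler_norm_sum _ _ _) _.
  apply: le_trans (_ : _ <= M * s ^+ 3 * \sum_(i < D) (i.+2%:R ^+ 6)^-1) _; last first.
    apply: ler_wpM2l; last exact: sum_inv_exp6_le.
    by rewrite mulr_ge0 ?(ltW s3)//; exact: le_trans Mc.
  rewrite mulr_sumr; apply: ler_sum => i _.
  set d : R := (bump 0 i).+1%:R.
  have d2 : 2 <= d by rewrite /d ler_nat.
  have d0 : 0 < d by lra.
  have sd0 : 0 < s / d ^+ 2 by rewrite divr_gt0// exprn_gt0.
  have := IH (s / d ^+ 2) sd0.
  have -> : c / Z * (s / d ^+ 2) ^+ 5 = c / Z * s ^+ 5 * (d ^+ 10)^-1.
    by field; rewrite !gt_eqF.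
  have -> : M * (s / d ^+ 2) ^+ 3 = M * s ^+ 3 * (d ^+ 6)^-1.
    by field; rewrite !gt_eqF.
  apply; rewrite ltr_pdivrMr ?exprn_gt0//.
  by apply: lt_le_trans sk _; rewrite exprSr ler_wpM2l ?exprn_ge0//; nra.
set Ns := N s in TKs *.
(* Three errors: that of [T], the zeta truncation, and the terms [d >= 2]. *)
have -> : Ns - c / Z * s ^+ 5 = (Ns + b - c * s ^+ 5)
   + c * s ^+ 5 * (1 - (1 + a) / Z) - (b - c / Z * s ^+ 5 * a).
  by field; rewrite gt_eqF.
apply: le_trans (ler_normB _ _) _.
apply: le_trans (lerD (le_trans (ler_normD _ _) (lerD TKs zD)) fab) _.
nra.
Qed.

(** * Integer boxes and singular curves *)

Definition int_ball (n : nat) : {fset int} :=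
  [fset i%:Z - n%:Z | i in iota 0 n.*2.+1]%fset.

Lemma in_int_ball (n : nat) (z : int) : (z \in int_ball n) = (`|z| <= n)%N.
Proof.
apply/imfsetP/idP => /= [[i]|zn].
  rewrite inE mem_iota => ilt ->; lia.
by exists (absz (z + n%:Z)); rewrite ?inE ?mem_iota; lia.
Qed.

Lemma card_int_ball (n : nat) : #|` int_ball n|%fset = n.*2.+1.
Proof.
rewrite card_imfset; last by move=> i j /addIr [].
rewrite -[RHS](size_iota 0); apply/perm_size/uniq_perm => [||z].
- exact: enum_finmem_uniq.
- exact: iota_uniq.
- exact: enum_finmemE.
Qed.

Lemma in_fset_filter (K : choiceType) (A : {fset K}) (P : pred K) (x : K) :
  (x \in [fset y in A | P y]%fset) = (x \in A) && P x.
Proof. by rewrite !inE. Qed.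

Lemma card_fsetM (K K' : choiceType) (A : {fset K}) (B : {fset K'}) :
  (#|` A `*` B| = #|` A| * #|` B|)%fset%N.
Proof.
rewrite -[RHS](size_allpairs pair (enum_fset A) (enum_fset B)).
apply/perm_size/uniq_perm => [||[x y]]; first exact: fset_uniq.
  by rewrite allpairs_uniq// => -[? ?] [? ?].
rewrite in_fsetM/=; apply/andP/allpairsP => [[xA yB]|[[a b] [aA bB [-> ->]]]] //.
by exists (x, y).
Qed.

Lemma int_cube_inj : injective (fun A : int => A ^+ 3).
Proof.
have H (A B : int) : A < B -> A ^+ 3 < B ^+ 3.
  move=> AB; rewrite -(ltr_pM2l (_ : 0 < 4)) // -subr_gt0.
  (* The factor 4 completes the square in [A^2 + A B + B^2] over the integers. *)
  have -> : 4 * B ^+ 3 - 4 * A ^+ 3 = (B - A) ^+ 3 + (B - A) * (3 * (A + B) ^+ 2) by ring.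
  rewrite ltr_wpDr//; last by rewrite exprn_gt0// subr_gt0.
  apply: mulr_ge0; first by rewrite subr_ge0 ltW.
  by apply: mulr_ge0 => //; apply: sqr_ge0.
move=> A B /= AB; have [/H|/H|//] := ltgtP A B; by rewrite AB ltxx.
Qed.

(** On a singular curve [4 A^3 = -27 B^2], so [B] determines [A]: at most one singular pair for each
    [B]. *)
Lemma card_disc_eq0 (m n : nat) :
  (#|` [fset E in int_ball m `*` int_ball n | disc E == 0]| <= n.*2.+1)%fset%N.
Proof.
set S := [fset E in _ | _]%fset.
have snd_inj : {in S &, injective (fun E : weierstrass => E.2)}.
  move=> [A B] [A' B']; rewrite !inE => /andP[_ /eqP d1] /andP[_ /eqP d2] /= BB.
  rewrite -BB; congr pair; move: d1 d2; rewrite /disc/= -BB => d1 d2.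
  by apply: int_cube_inj => /=; lia.
rewrite -(eqP (introT (card_in_imfsetP _ _) snd_inj)) -card_int_ball.
apply: fsubset_leq_card; apply/fsubsetP => z.
by move=> /imfsetP[E /=]; rewrite !inE => /andP[/andP[_ ? _]] ->.
Qed.

(** * Lower bound and finiteness for the height *)

Lemma height_ge1 (R : realType) (alpha beta : R) (E : weierstrass) :
  1 <= alpha -> 1 <= beta -> all_curves E -> 1 <= height alpha beta E.
Proof.
move=> a1 b1; have abs_ge1 (z : int) : z != 0 -> 1 <= `|z%:~R : R|.
  by move=> z0; rewrite -intr_norm -[1]/(1%:~R) ler_int; lia.
case: E => A B; rewrite /all_curves/= le_max.
have [->|/abs_ge1 A1] := eqVneq A 0; last first.
  by move=> _; rewrite mulr_ege1// exprn_ege1.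
have [->|/abs_ge1 B1] := eqVneq B 0; first by [].
by move=> _; rewrite orbC -real_normK ?num_real// mulr_ege1// exprn_ege1.
Qed.

Lemma ncurves_lt1 (R : realType) (alpha beta : R) (F : set weierstrass) (X : R) :
  1 <= alpha -> 1 <= beta -> F `<=` all_curves -> X < 1 ->
  ncurves alpha beta F X = 0%N.
Proof.
move=> a1 b1 FA X1; rewrite /ncurves (_ : bounded_height _ _ _ _ = set0) ?fset_set0//.
rewrite -subset0 => E [/FA/(height_ge1 a1 b1) + hX].
by move=> /le_trans/(_ hX); rewrite leNgt X1.
Qed.

(** Since [|z| <= |z|^k] for an integer [z] and [k >= 1], both coefficients are at most [X] in
    absolute value. Thus [fset_set] never falls back on its empty default. *)
Lemma finite_bounded_height (R : realType) (alpha beta : R)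
    (F : set weierstrass) (X : R) :
  1 <= alpha -> 1 <= beta -> finite_set (bounded_height alpha beta F X).
Proof.
move=> a1 b1; set n := Num.trunc X.
apply: sub_finite_set (finite_fset (int_ball n `*` int_ball n)%fset).
move=> [A B] [_ /=]; rewrite /height ge_max/= => /andP[AX BX].
have abs_le (z : int) k : `|z|%N%:R <= `|z%:~R : R| ^+ k.+1.
  rewrite -intr_norm -abszE -pmulrn -natrX ler_nat.
  by case: `|z|%N => // m; rewrite -{1}[m.+1]expn1 leq_pexp2l.
have X0 : 0 <= X by apply: le_trans AX; rewrite mulr_ge0 ?exprn_ge0//; lra.
rewrite in_fsetM !in_int_ball !truncn_ge_nat//=; apply/andP; split.
  apply: le_trans AX; apply: le_trans (abs_le A 2) _.
  by rewrite ler_peMl// exprn_ge0.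
apply: le_trans BX; apply: le_trans (abs_le B 1) _.
by rewrite real_normK ?num_real// ler_peMl// sqr_ge0.
Qed.

(** * Counting all curves of bounded height *)

Section Count.
Variables (R : realType) (alpha beta u v : R).
Hypotheses (u0 : 0 < u) (v0 : 0 < v).
Hypotheses (uE : u ^+ 3 * alpha = 1) (vE : v ^+ 2 * beta = 1).

(** Here [u = alpha^(-1/3)] and [v = beta^(-1/2)], so the height condition is the box
    [|A| <= u s^2], [|B| <= v s^3]. *)
Lemma height_le (s : R) (E : weierstrass) : 0 < s ->
  (height alpha beta E <= s ^+ 6) =
  (E \in int_ball (Num.trunc (s ^+ 2 * u)) `*` int_ball (Num.trunc (s ^+ 3 * v)))%fset.
Proof.
move=> s0.
have su : 0 <= s ^+ 2 * u by rewrite ltW// mulr_gt0// exprn_gt0.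
have sv : 0 <= s ^+ 3 * v by rewrite ltW// mulr_gt0// exprn_gt0.
rewrite in_fsetM !in_int_ball /height ge_max !truncn_ge_nat//.
have absE (z : int) : `|z|%N%:R = `|z%:~R| :> R.
  by rewrite pmulrn abszE intr_norm.
rewrite !absE; congr andb.
- rewrite -[RHS](@ler_pXn2r _ 3)// ?nnegrE//.
  rewrite -(ler_pM2l (exprn_gt0 3 u0)) mulrA uE mul1r.
  by congr (_ <= _); ring.
- rewrite -[RHS](@ler_pXn2r _ 2)// ?nnegrE//.
  rewrite -(ler_pM2l (exprn_gt0 2 v0)) mulrA vE mul1r real_normK ?num_real//.
  by congr (_ <= _); ring.
Qed.

Lemma ncurves_all_bounds (s : R) : 1 <= alpha -> 1 <= beta -> 0 < s ->
  let m := Num.trunc (s ^+ 2 * u) in let n := Num.trunc (s ^+ 3 * v) in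
  (m.*2.+1 * n.*2.+1 <= ncurves alpha beta all_curves (s ^+ 6) + n.*2.+1)%N /\
  (ncurves alpha beta all_curves (s ^+ 6) <= m.*2.+1 * n.*2.+1)%N.
Proof.
move=> a1 b1 s0 m n.
have -> : ncurves alpha beta all_curves (s ^+ 6) =
    #|` [fset E in int_ball m `*` int_ball n | disc E != 0]|%fset.
  rewrite /ncurves; congr #|` _|%fset; apply/fsetP => E.
  rewrite in_fset_set; last exact: finite_bounded_height.
  rewrite in_fset_filter -height_le//.
  apply/idP/idP; rewrite inE/=; last by move=> /andP[].
  by case=> dE hE; apply/andP.
have := card_disc_eq0 m n.
have : (m.*2.+1 * n.*2.+1 = #|` int_ball m `*` int_ball n|)%fset%N.
  by rewrite card_fsetM !card_int_ball.
(* The box [P] splits into its singular and nonsingular pairs. *)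
set P := (X in #|` X|%fset); rewrite -(cardfsID [fset E in P | disc E == 0]%fset P).
rewrite -/P.
have -> : (P `&` [fset E in P | disc E == 0] = [fset E in P | disc E == 0])%fset.
  by apply/fsetP => E; rewrite in_fsetI !in_fset_filter; case: (E \in P).
have -> : (P `\` [fset E in P | disc E == 0] = [fset E in P | disc E != 0])%fset.
  by apply/fsetP => E; rewrite in_fsetD !in_fset_filter; case: (E \in P);
    rewrite /= ?andbT ?andbF.
by move=> -> sing; rewrite leq_addl addnC leq_add2l.
Qed.
(** The box has area [4 u v s^5]; both the rounding of its sides and the singular pairs cost
    [O(s^3)]. *)
Lemma ncurves_all_estimate (s : R) : 1 <= alpha -> 1 <= beta -> 0 < s ->
  `|(ncurves alpha beta all_curves (s ^+ 6))%:R - 4 * u * v * s ^+ 5|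
    <= 8 * s ^+ 3.
Proof.
move=> a1 b1 s0.
have u1 : u <= 1.
  by rewrite -(@expr_le1 _ 3)//; [rewrite -uE ler_peMr// exprn_ge0// ltW|exact: ltW].
have v1 : v <= 1.
  by rewrite -(@expr_le1 _ 2)//; [rewrite -vE ler_peMr// exprn_ge0// ltW|exact: ltW].
(* Below 1 the count is 0 and the main term is itself at most [4 s^3]. *)
have [s1|s1] := ltP s 1.
  rewrite ncurves_lt1//; last by rewrite exprn_ilt1// ltW.
  have s5 : s ^+ 5 <= s ^+ 3 by apply: ler_wiXn2l => //; exact: ltW.
  have s50 : 0 < s ^+ 5 by exact: exprn_gt0.
  have -> : 4 * u * v * s ^+ 5 = 4 * (u * v * s ^+ 5) by ring.
  have uvs0 : 0 < u * v * s ^+ 5 by rewrite !mulr_gt0.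
  have uvs : u * v * s ^+ 5 <= s ^+ 3.
    by apply: le_trans s5; rewrite ler_piMl ?mulr_ile1// ltW.
  by rewrite sub0r normrN ger0_norm; lra.
have [lo hi] := ncurves_all_bounds a1 b1 s0.
set N := ncurves _ _ _ _ in lo hi *.
set x := s ^+ 2 * u in lo hi; set y := s ^+ 3 * v in lo hi.
have x0 : 0 <= x by rewrite ltW// mulr_gt0// exprn_gt0.
have y0 : 0 <= y by rewrite ltW// mulr_gt0// exprn_gt0.
have /andP[mx xm] := truncn_itv x0; have /andP[ny yn] := truncn_itv y0.
rewrite -natr1 in xm; rewrite -natr1 in yn.
move: lo hi mx xm ny yn; move: (Num.trunc x) (Num.trunc y) => m n.
have dblE (k : nat) : k.*2.+1%:R = 2 * k%:R + 1 :> R.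
  by rewrite -natr1 -mul2n natrM.
rewrite -!(ler_nat R) natrD !natrM !dblE.
move: (m%:R : R) (n%:R : R) (N%:R : R) => {}m {}n {}N lo hi mx xm ny yn.
have -> : 4 * u * v * s ^+ 5 = 4 * (x * y) by rewrite /x /y; ring.
have s3 : 1 <= s ^+ 3 by rewrite exprn_ege1.
have s23 : s ^+ 2 <= s ^+ 3 by apply: ler_weXn2l.
have xs : x <= s ^+ 3 by apply: le_trans s23; rewrite ler_piMr// exprn_ge0// ltW.
have ys : y <= s ^+ 3 by rewrite ler_piMr// exprn_ge0// ltW.
clearbody x y; set t := s ^+ 3 in s3 xs ys *; clearbody t.
(* One side is rounded at a time. The errors are at most [2y + 1], [2n + 1] and [2x]; with [n <= y]
   and [x, y <= t] they add up to [6t + 2 <= 8t], as [t >= 1]. *)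
have -> : N - 4 * (x * y) = (N - (2 * m + 1) * (2 * n + 1)) +
  (2 * m + 1 - 2 * x) * (2 * n + 1) + 2 * x * (2 * n + 1 - 2 * y) by ring.
have p1 : `|2 * m + 1 - 2 * x| <= 1 by rewrite ler_norml; apply/andP; split; lra.
have p2 : `|2 * n + 1 - 2 * y| <= 1 by rewrite ler_norml; apply/andP; split; lra.
have p3 : `|N - (2 * m + 1) * (2 * n + 1)| <= 2 * y + 1.
  by rewrite ler_norml; apply/andP; split; lra.
have n0 : 0 <= 2 * n + 1 by lra.
apply: le_trans (ler_normD _ _) _; apply: le_trans (lerD (ler_normD _ _) (lexx _)) _.
rewrite !normrM (ger0_norm n0) (ger0_norm x0) (@ger0_norm _ 2)//.
have q1 := ler_wpM2r n0 p1.
have q2 : 2 * x * `|2 * n + 1 - 2 * y| <= 2 * x by rewrite ler_piMr// mulr_ge0.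
lra.
Qed.
End Count.

(** * Sorting all curves by their minimal twist *)

(** The twists by [d = i + 1] of minimal curves are disjoint for distinct [d] and exhaust all
    curves; the twist scales the height bound by [d^12]. *)
Lemma ncurves_all_sum (R : realType) (alpha beta s : R) (D : nat) :
  1 <= alpha -> 1 <= beta -> 0 < s -> s ^+ 6 <= D%:R ->
  ncurves alpha beta all_curves (s ^+ 6) =
  (\sum_(i < D) ncurves alpha beta minimal_curves ((s / i.+1%:R ^+ 2) ^+ 6))%N.
Proof.
move=> a1 b1 s0 sD.
have si0 i : 0 < s / i.+1%:R ^+ 2 by rewrite divr_gt0// exprn_gt0.
pose B i := bounded_height alpha beta minimal_curves ((s / i.+1%:R ^+ 2) ^+ 6).
have hE i E : (height alpha beta E <= (s / i.+1%:R ^+ 2) ^+ 6) =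
    (height alpha beta (twist i.+1 E) <= s ^+ 6).
  rewrite height_twist -[RHS]ler_pdivlMl ?exprn_gt0//; congr (_ <= _).
  by field; rewrite gt_eqF.
transitivity (\sum_(i < D) #|` fset_set (twist i.+1 @` B i)|%fset)%N; last first.
  apply: eq_bigr => i _.
  rewrite fset_set_image ?card_imfset//; first exact: twist_inj.
  exact: finite_bounded_height.
rewrite (@trivIset_sum_card _ (fun i => twist i.+1 @` B i)); last first.
- move=> i j _ _ [_ [[E [Emin _] <-]]] [E' [E'min _] eqE].
  by apply/eq_add_S/esym; apply: twist_minimal_uniq eqE.
- by move=> i; apply: finite_image; exact: finite_bounded_height.
congr #|` _|%fset; congr fset_set.
rewrite -(bigcup_mkord D (fun i => twist i.+1 @` B i)).
apply/seteqP; split=> [E [Eall Es]|E].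
  have [d [E' [d0 E'min EE]]] := twist_minimal_exists Eall.
  case: d d0 EE => // d _ EE.
  exists d; last first.
    by exists E' => //; split=> //=; rewrite hE -EE.
  (* No twist beyond [D] occurs: with [d] for the twisting factor,
     [d <= d^12 <= d^12 H(E') <= s^6 <= D], as minimal curves have height at least 1. *)
  rewrite /= -(ler_nat R); apply: le_trans sD; apply: le_trans Es.
  rewrite EE height_twist; apply: (@le_trans _ _ (d.+1%:R ^+ 12)).
    by rewrite ler_eXnr// ler1n.
  by rewrite ler_peMr ?exprn_ge0//; apply: height_ge1 => //; case: E'min.
move=> [d _ [E' [E'min E's] <-]]; split=> /=.
  by apply/all_curves_twist => //; case: E'min.
by rewrite -hE.
Qed.

(** * The ratio of the two counts *)

Theorem theorem2p9 (R : realType) (alpha beta : R)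
    (halpha : 1 <= alpha) (hbeta : 1 <= beta) :
  exists2 C : R, 0 < C &
    \forall X \near +oo,
      `| (ncurves alpha beta minimal_curves X)%:R
           / (ncurves alpha beta all_curves X)%:R
         - (zeta 10)^-1 | <= C * X `^ (- 3^-1).
Proof.
have a0 : 0 < alpha by lra.
have b0 : 0 < beta by lra.
pose u := alpha `^ (- 3^-1); pose v := beta `^ (- 2^-1).
have u0 : 0 < u by rewrite powR_gt0.
have v0 : 0 < v by rewrite powR_gt0.
have uE : u ^+ 3 * alpha = 1.
  rewrite -powR_mulrn ?powR_ge0// -powRrM mulNr mulVf// powRN powRr1 ?ltW//.
  by rewrite mulVf// gt_eqF.
have vE : v ^+ 2 * beta = 1.
  rewrite -powR_mulrn ?powR_ge0// -powRrM mulNr mulVf// powRN powRr1 ?ltW//.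
  by rewrite mulVf// gt_eqF.
pose c := 4 * u * v.
have c0 : 0 < c by rewrite !mulr_gt0.
pose N s : R := (ncurves alpha beta minimal_curves (s ^+ 6))%:R.
pose T s : R := (ncurves alpha beta all_curves (s ^+ 6))%:R.
have TE s : 0 < s -> `|T s - c * s ^+ 5| <= 8 * s ^+ 3.
  exact: ncurves_all_estimate.
have [M MP] : exists M, forall s, 0 < s ->
    `|N s - c / zeta 10 * s ^+ 5| <= M * s ^+ 3.
  apply: (@sieve_inversion R N T c 8 (ltW c0)) => // [s s0 s1|s D s0 sD].
    by rewrite /N (ncurves_lt1 halpha hbeta)// => [E []//|]; rewrite exprn_ilt1// ltW.
  by rewrite /T (ncurves_all_sum halpha hbeta s0 sD) natr_sum.
have Z1 := zeta10_ge1 R; set Z := zeta 10 in MP Z1 *.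
have M0 : 0 <= M by have := le_trans (normr_ge0 _) (MP 1 ltr01); rewrite expr1n mulr1.
(* The quotient is [(M + 8) s^3] divided by the lower bound [c s^5 / 2] for [T s], without its
   factor [s^-2]. *)
exists (2 * (M + 8) / c + 1).
  by rewrite ltr_wpDl// divr_ge0 ?ltW// mulr_gt0//; lra.
near=> X.
have X0 : 0 < X by near: X; exact: nbhs_pinfty_gt.
(* This says [c s^2 >= 16], so the error [8 s^3] in [T s] is at most half of the main term
   [c s^5]. *)
have Xbig : (16 / c) ^+ 3 <= X by near: X; apply: nbhs_pinfty_ge; exact: num_real.
pose s := X `^ 6^-1.
have s0 : 0 < s by rewrite powR_gt0.
have sX : s ^+ 6 = X by rewrite -powR_mulrn ?powR_ge0// -powRrM mulVf// powRr1// ltW.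
have -> : X `^ (- 3^-1) = s ^- 2.
  rewrite -powR_invn ?powR_ge0// -powRrM; congr (_ `^ _); lra.
have s20 : 0 < s ^+ 2 by rewrite exprn_gt0.
have sbig : 16 <= c * s ^+ 2.
  rewrite mulrC -ler_pdivrMr// -(@ler_pXn2r _ 3)// ?nnegrE.
  - by rewrite -exprM sX.
  - by rewrite divr_ge0// ltW.
  - by rewrite ltW.
have s30 : 0 < s ^+ 3 by rewrite exprn_gt0.
rewrite -sX -/(N s) -/(T s).
have Tbig : c * s ^+ 5 / 2 <= T s.
  have := TE s s0; rewrite ler_norml => /andP[+ _].
  rewrite (_ : c * s ^+ 5 = c * s ^+ 2 * s ^+ 3); last by ring.
  by nra.
have T0 : 0 < T s by apply: lt_le_trans Tbig; rewrite divr_gt0// mulr_gt0// exprn_gt0.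
(* The main terms of [N s] and [T s / Z] are both [c s^5 / Z] and cancel. *)
have -> : N s / T s - Z^-1 =
    ((N s - c / Z * s ^+ 5) - (T s - c * s ^+ 5) / Z) / T s.
  by field; rewrite !gt_eqF//; lra.
rewrite normrM normfV (gtr0_norm T0) ler_pdivrMr//.
apply: (@le_trans _ _ ((M + 8) * s ^+ 3)).
  apply: le_trans (ler_normB _ _) _; rewrite [leRHS]mulrDl.
  apply: lerD; first exact: MP.
  rewrite normrM; apply: le_trans (TE s s0).
  rewrite ler_piMr// ger0_norm ?invr_ge0 ?invf_le1; lra.
apply: (@le_trans _ _ (2 * (M + 8) / c * s ^- 2 * (c * s ^+ 5 / 2))).
  rewrite le_eqVlt; apply/orP; left; apply/eqP; field.
  by rewrite !gt_eqF.
apply: ler_pM => //.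
- by rewrite mulr_ge0 ?invr_ge0 ?(ltW s20)// divr_ge0 ?(ltW c0)//; lra.
- by rewrite ltW// divr_gt0// mulr_gt0// exprn_gt0.
- by apply: ler_wpM2r; [rewrite invr_ge0 ltW|lra].
Unshelve. all: by end_near.
Qed.
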